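(* Let $d\ge 1$ and let $C\subseteq\mathbb{R}^d$ be a set of size $n\le 4$. Then $\Psi(C)$ is exactly the set of protrusive orderings of $C$.
   Context: For a finite multiset $V$ of points in $\mathbb{R}^d$, $D_V(x)=\sum_{v\in V}\|x-v\|$ (Euclidean norm, with multiplicity). $V$ distinguishes $C$ if the values $D_V(c)$, $c\in C$, are pairwise distinct, and then witnesses the ordering of $C$ by increasing $D_V$-value. $\Psi(C)$ is the set of all orderings of $C$ witnessed by finite nonempty multisets $V\subseteq\mathbb{R}^d$ distinguishing $C$. An ordering $(x_1,\dots,x_n)$ is protrusive if for every $i\in[n-1]$, $x_{i+1}$ is not in the convex hull of $x_1,\dots,x_i$. *)

(* Defs.v *)
From HB Require Import structures.
From mathcomp Require Import all_boot all_order all_algebra.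
From mathcomp Require Import finmap multiset.
From mathcomp Require Import boolp classical_sets reals convex.

Set Implicit Arguments.
Unset Strict Implicit.
Unset Printing Implicit Defensive.

Import Order.TTheory GRing.Theory Num.Theory.

Local Open Scope classical_set_scope.
Local Open Scope ring_scope.

(* The library norm on 'rV[R]_d is the sup norm. *)
Definition enorm (R : realType) (d : nat) (x : 'rV[R]_d) : R :=
  Num.sqrt (\sum_(i < d) (x ord0 i) ^+ 2).

(* [enum_mset V] lists the elements of V with multiplicity. *)
Definition dist_sum (R : realType) (d : nat) (V : {mset 'rV[R]_d}%mset)
    (x : 'rV[R]_d) : R :=
  \sum_(v <- enum_mset V) enorm (x - v).

Definition distinguishes (R : realType) (d : nat)
    (V : {mset 'rV[R]_d}%mset) (C : {fset 'rV[R]_d}) : Prop :=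
  {in C &, injective (dist_sum V)}.

Definition ordering (R : realType) (d : nat) (C : {fset 'rV[R]_d})
    (s : seq 'rV[R]_d) : Prop :=
  uniq s /\ s =i C.

Definition witnesses (R : realType) (d : nat) (V : {mset 'rV[R]_d}%mset)
    (C : {fset 'rV[R]_d}) (s : seq 'rV[R]_d) : Prop :=
  [/\ distinguishes V C, ordering C s &
      sorted (fun x y => dist_sum V x < dist_sum V y) s].

Definition Psi (R : realType) (d : nat) (C : {fset 'rV[R]_d}) :
    set (seq 'rV[R]_d) :=
  [set s | exists V : {mset 'rV[R]_d}%mset, V <> mset0 /\ witnesses V C s].

Definition convex_hull (R : realType) (d : nat) (A : set 'rV[R]_d) :
    set 'rV[R]_d :=
  smallest (@convex_set R 'rV[R]_d) A.

(* With 0-based indexing, x_{i+1} is [nth 0 s i] and x_1, ..., x_i are the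
   entries of [take i s]; i ranges over 1 <= i <= n - 1. *)
Definition protrusive (R : realType) (d : nat) (s : seq 'rV[R]_d) : Prop :=
  forall i : nat, (0 < i < size s)%N ->
    ~ convex_hull [set x | x \in take i s] (nth 0 s i).

(* Main.v *)
Require Import Defs.
From HB Require Import structures.
From mathcomp Require Import all_boot all_order all_algebra.
From mathcomp Require Import finmap multiset.
From mathcomp Require Import boolp classical_sets functions reals convex.
From mathcomp Require Import interval_inference ring lra.

(** Each [D_V] is convex, so an ordering by increasing [D_V] is protrusive.
    Conversely, for a protrusive [x_1, ..., x_n], the vectors of increments
    [D_V x_(i+1) - D_V x_i] form an additive semigroup. If it misses the open
    positive orthant, some nonzero [w >= 0] is nonpositive on it, and summation
    by parts turns [w] into weights [m] of sum [0], the last nonzero one being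
    positive, with [\sum_j m_j |x_j - v| <= 0] for all [v]. Sending [v] to
    infinity gives [\sum_j m_j x_j = 0]. A point that is alone in having
    positive weight is then in the hull of those of negative weight. If two of
    at most four points have positive weight, at most two, [y] and [z], have
    negative weight: [v = y] is an equality case of the triangle inequality,
    which puts the positive points on the ray from [y] through [z], and [v = z]
    puts them on the opposite ray, hence on the segment [y, z]. Either way the
    last point of nonzero weight is in the hull of earlier points. *)

Set Implicit Arguments.
Unset Strict Implicit.
Unset Printing Implicit Defensive.

Import Order.TTheory GRing.Theory Num.Theory.

Local Open Scope classical_set_scope.
Local Open Scope convex_scope.
Local Open Scope ring_scope.

Lemma sorted_lt_inj d (T : eqType) (T' : porderType d) (f : T -> T')
    (s : seq T) :
  sorted (fun x y => f x < f y)%O s -> {in s &, injective f}.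
Proof.
move=> s_sorted x y xs ys fxy.
have f_uniq : uniq (map f s).
  by rewrite (sorted_uniq lt_trans ltxx)// sorted_map.
rewrite -[x](nth_index x xs) -[RHS](nth_index x ys); congr nth.
apply/eqP; rewrite -(nth_uniq (f x) _ _ f_uniq) ?size_map ?index_mem//.
by rewrite !(nth_map x) ?index_mem// !nth_index// fxy.
Qed.

Lemma card_le2_sub_set2 (T : finType) (A : {set T}) x :
  x \in A -> (#|A| <= 2)%N ->
  exists2 y, y \in A & A \subset [set x; y]%SET.
Proof.
move=> Ax; rewrite (cardsD1 x) Ax ltnS => /card_le1_eqP A1.
have [A0|[y Ay]] := set_0Vmem (A :\ x).
  exists x => //; apply/fintype.subsetP => z Az; rewrite !inE orbb.
  by apply: contra_eqT A0 => zx; apply/set0Pn; exists z; rewrite !inE zx.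
exists y; first by case/setD1P: Ay.
apply/fintype.subsetP => z Az; rewrite !inE; have [//|zx] := eqVneq z x.
by apply/eqP/A1; rewrite // !inE zx.
Qed.

Lemma sum0_exists_lt0 (R : realDomainType) (I : finType) (F : I -> R) k :
  \sum_i F i = 0 -> 0 < F k -> exists i, F i < 0.
Proof.
move=> F_sum0 Fk; apply: contrapT => no_neg.
have F_ge0 i : 0 <= F i.
  by rewrite leNgt; apply/negP => Fi; apply: no_neg; exists i.
by move: Fk; rewrite (psumr_eq0P (fun i _ => F_ge0 i) F_sum0)// ltxx.
Qed.

Lemma sum_neg_part_unique_pos (R : realDomainType) (V : zmodType)
    (I : finType) (m : I -> R) (F : I -> V) k :
  0 < m k -> (forall i, i != k -> m i <= 0) -> (forall i, m i = 0 -> F i = 0) ->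
  \sum_i F i = 0 -> \sum_(i | m i < 0) - F i = F k.
Proof.
move=> mk m_npos Fm0; rewrite (bigD1 k)//= (bigID (fun i => m i < 0)) /=.
rewrite [X in _ + (_ + X)]big1 => [|i /andP[ik]]; last first.
  by rewrite -leNgt => mi; apply: Fm0; apply/le_anti; rewrite m_npos.
rewrite addr0 sumrN => /eqP; rewrite addr_eq0 => /eqP ->; congr (- _).
apply: eq_bigl => i; have [->|//] := eqVneq i k.
by rewrite ltNge ltW.
Qed.

Definition backward_diff (V : zmodType) (w : nat -> V) (j : nat) : V :=
  (if j is i.+1 then w i else 0) - w j.

Lemma sum_backward_diffM (R : pzRingType) (w f : nat -> R) n : w n = 0 ->
  \sum_(j < n.+1) backward_diff w j * f j =
  \sum_(i < n) w i * (f i.+1 - f i).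
Proof.
move=> wn0; rewrite /backward_diff.
under eq_bigr do rewrite mulrBl.
rewrite sumrB big_ord_recl [X in _ - X]big_ord_recr /= wn0 !mul0r add0r addr0.
by rewrite -sumrB; under [RHS]eq_bigr do rewrite mulrBr.
Qed.

Lemma sum_backward_diff (V : zmodType) (w : nat -> V) n :
  w n = 0 -> \sum_(j < n.+1) backward_diff w j = 0.
Proof.
move=> wn0; rewrite /backward_diff sumrB big_ord_recl [X in _ - X]big_ord_recr.
by rewrite /= wn0 add0r addr0 subrr.
Qed.

Lemma backward_diff_last_pos (R : realDomainType) (w : nat -> R) n :
    (forall i, 0 <= w i) -> (forall i, (n < i)%N -> w i = 0) ->
    (exists i, 0 < w i) ->
  exists k, [/\ (k <= n)%N, 0 < backward_diff w k.+1 &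
    forall j, backward_diff w j < 0 -> (j <= k)%N].
Proof.
move=> w_ge0 w_supp w_pos.
have le_n i : 0 < w i -> (i <= n)%N.
  by apply: contraTT; rewrite -ltnNge => /w_supp ->; rewrite ltxx.
case: (ex_maxnP w_pos le_n) => k wk k_max.
have w_after i : (k < i)%N -> w i = 0.
  move=> ki; apply/le_anti; rewrite w_ge0 andbT leNgt.
  by apply/negP => /k_max; rewrite leqNgt ki.
exists k; split; first exact: le_n.
  by rewrite /backward_diff (w_after k.+1)// subr0.
move=> j; apply: contraTT; rewrite -ltnNge -leNgt /backward_diff => kj.
by rewrite (w_after j kj) subr0; case: j {kj}.
Qed.

Definition add_closed (V : nmodType) (S : set V) : Prop :=
  forall u v, S u -> S v -> S (u + v).

Lemma add_closedMn (V : nmodType) (S : set V) u n :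
  add_closed S -> S u -> S (u *+ n.+1).
Proof.
by move=> SD Su; elim: n => // n IHn; rewrite mulrS; exact: SD.
Qed.

Lemma natmul_truncnS_ge (R : archiRealFieldType) (x r : R) :
  0 <= x -> x * r - `|r| <= r *+ (Num.truncn x).+1.
Proof.
move=> /truncn_itv/andP[lo up]; rewrite -[r *+ _]mulr_natl -natr1 in up *.
by case: ger0P => r0; nra.
Qed.

Lemma gt0_nat_combination (R : archiRealFieldType) (a b p q : R) :
  0 <= a -> 0 <= b -> 0 < a * p + b * q ->
  exists N, forall n, (N <= n)%N ->
    0 < p *+ (Num.truncn (n%:R * a)).+1 + q *+ (Num.truncn (n%:R * b)).+1.
Proof.
move=> a0 b0 e0; set e := a * p + b * q in e0.
exists (Num.bound ((`|p| + `|q|) / e)) => n le_n.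
have ne : `|p| + `|q| < n%:R * e.
  rewrite -ltr_pdivrMr// (lt_le_trans (archi_boundP _)) ?ler_nat//.
  by rewrite divr_ge0 ?(ltW e0)// addr_ge0.
have := natmul_truncnS_ge p (mulr_ge0 (ler0n R n) a0).
have := natmul_truncnS_ge q (mulr_ge0 (ler0n R n) b0).
by rewrite /e in ne; lra.
Qed.

Section PlanarSemigroup.
Variables (R : realType) (S : set (R * R)).
Hypotheses (SD : add_closed S) (S_neg : forall u, S u -> 0 < u.1 -> u.2 <= 0).

Lemma conic_combination_le0 u v (a b : R) : S u -> S v -> 0 <= a -> 0 <= b ->
  0 < a * u.1 + b * v.1 -> a * u.2 + b * v.2 <= 0.
Proof.
move=> Su Sv a0 b0 fst_gt0; rewrite leNgt; apply/negP => snd_gt0.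
have [N1 N1P] := gt0_nat_combination a0 b0 fst_gt0.
have [N2 N2P] := gt0_nat_combination a0 b0 snd_gt0.
pose n := maxn N1 N2.
have := S_neg (SD (add_closedMn (Num.truncn (n%:R * a)) SD Su)
                  (add_closedMn (Num.truncn (n%:R * b)) SD Sv)).
rewrite /= !raddfMn /= N1P ?leq_maxl// => /(_ isT).
by rewrite leNgt N2P// leq_maxr.
Qed.

(* The combination (v.1 - v.2) u + (u.2 - u.1) v lies on the diagonal. *)
Lemma opposite_quadrant_slopes u v : S u -> S v -> 0 < u.2 -> 0 < v.1 ->
  u.2 * v.1 <= u.1 * v.2.
Proof.
move=> Su Sv u2 v1; have v2 := S_neg Sv v1.
have u1 : u.1 <= 0.
  by rewrite leNgt; apply/negP => /(S_neg Su); rewrite leNgt u2.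
rewrite leNgt; apply/negP => det_gt0.
have := @conic_combination_le0 u v (v.1 - v.2) (u.2 - u.1) Su Sv; lra.
Qed.

Lemma add_closed_nonpos_functional2 : exists s t,
  [/\ 0 <= s, 0 <= t, 0 < s + t & forall u, S u -> s * u.1 + t * u.2 <= 0].
Proof.
have [[v Sv v1]|no_pos] := pselect (exists2 v, S v & 0 < v.1); last first.
  exists 1, 0; split; rewrite ?addr0// => u Su.
  by rewrite mul1r mul0r addr0 leNgt; apply/negP => u1; apply: no_pos; exists u.
pose F := [set - u.2 / u.1 | u in [set u | S u /\ 0 < u.1]].
have F_ge0 : lbound F 0.
  by move=> _ [u [Su u1] <-]; rewrite divr_ge0 ?oppr_ge0 ?S_neg// ltW.
have F_neq0 : F !=set0 by exists (- v.2 / v.1), v.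
have infF_ge0 : 0 <= inf F by exact: lb_le_inf.
exists (inf F), 1; split; rewrite ?ltr_wpDl// => u Su; rewrite mul1r.
have [u1|u1] := ltP 0 u.1.
  have : inf F <= - u.2 / u.1 by apply: ge_inf; [exists 0|exists u].
  by rewrite ler_pdivlMr//; lra.
have [u2|u2] := ltP 0 u.2; last by have := mulr_ge0_le0 infF_ge0 u1; lra.
have {}u1 : u.1 < 0.
  rewrite lt_neqAle u1 andbT; apply/eqP => u10.
  have := opposite_quadrant_slopes Su Sv u2 v1.
  by rewrite u10 mul0r leNgt mulr_gt0.
have : u.2 / - u.1 <= inf F.
  apply: lb_le_inf => // _ [v' [Sv' v'1] <-].
  rewrite ler_pdivrMr ?oppr_gt0// mulrAC ler_pdivlMr//.
  by have := opposite_quadrant_slopes Su Sv' u2 v'1; lra.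
by rewrite ler_pdivrMr ?oppr_gt0//; lra.
Qed.

End PlanarSemigroup.

(* Induction on n: the induction hypothesis applied to the part of S where the
   last coordinate is positive merges the other coordinates into one. *)
Lemma add_closed_nonpos_functional (R : realType) n (S : set (nat -> R)) :
  add_closed S -> (forall u, S u -> exists2 i, (i <= n)%N & u i <= 0) ->
  exists w : nat -> R,
    [/\ forall i, 0 <= w i, forall i, (n < i)%N -> w i = 0,
        exists i, 0 < w i &
        forall u, S u -> \sum_(i < n.+1) w i * u i <= 0].
Proof.
elim: n S => [|n IHn] S SD S_neg.
  exists (fun i => (i == 0)%:R); split=> [i|[]//||u Su]; first exact: ler0n.
    by exists 0; rewrite ltr01.
  by rewrite big_ord1 mul1r; have [[]] := S_neg u Su.
have [||w [w_ge0 w_supp [j wj] w_le0]] := IHn [set u | S u /\ 0 < u n.+1].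
- by move=> u v [Su un] [Sv vn]; split; [exact: SD|exact: addr_gt0].
- move=> u [Su un]; have [i] := S_neg u Su.
  by rewrite leq_eqVlt => /predU1P[->|]; [rewrite leNgt un|exists i].
pose wsum (u : nat -> R) := \sum_(i < n.+1) w i * u i.
have [||s [t [s0 t0 st0 st_le0]]] :=
    @add_closed_nonpos_functional2 R [set (u n.+1, wsum u) | u in S].
- move=> _ _ [u Su <-] [v Sv <-]; exists (u + v); first exact: SD.
  congr pair; rewrite /wsum -big_split; apply: eq_bigr => i _.
  by rewrite /= -mulrDr.
- by move=> _ [u Su <-] /= un; exact: w_le0.
exists (fun i => if i == n.+1 then s else t * w i); split=> [i|i ni||u Su].
- by case: ifP => // _; rewrite mulr_ge0.
- by rewrite gtn_eqF// w_supp ?mulr0// ltnW.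
- have [s_gt0|s_le0] := ltP 0 s; first by exists n.+1; rewrite eqxx.
  exists j; rewrite ltn_eqF; last first.
    by rewrite ltnS leqNgt; apply: contraTN wj => /w_supp ->; rewrite ltxx.
  by rewrite mulr_gt0//; lra.
rewrite big_ord_recr /= eqxx addrC.
rewrite (_ : \sum_(i < _) _ = t * wsum u); last first.
  by rewrite mulr_sumr; apply: eq_bigr => i _; rewrite ltn_eqF// mulrA.
by apply: (st_le0 (u n.+1, wsum u)); exists u.
Qed.

Section DotNorm.
Variables (R : rcfType) (U : lmodType R) (form : {dot U for @idfun R}).
Implicit Types (x y u v : U) (a t : R).

Local Notation "''[' u , v ]" := (form u v) : ring_scope.

Definition dotnorm u : R := Num.sqrt '[u, u].

Local Notation norm := dotnorm.

Lemma dotC u v : '[u, v] = '[v, u].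
Proof. by rewrite hermC mul1r. Qed.

Lemma dotDl u v x : '[u + v, x] = '[u, x] + '[v, x].
Proof. exact: linearDl. Qed.

Lemma dotDr u v x : '[x, u + v] = '[x, u] + '[x, v].
Proof. exact: linearDr. Qed.

Lemma dotNl u v : '[- u, v] = - '[u, v].
Proof. exact: linearNl. Qed.

Lemma dotNr u v : '[u, - v] = - '[u, v].
Proof. exact: linearNr. Qed.

Lemma dotZl a u v : '[a *: u, v] = a * '[u, v].
Proof. by rewrite linearZl_LR. Qed.

Lemma dotZr a u v : '[u, a *: v] = a * '[u, v].
Proof. by rewrite linearZr_LR. Qed.

Definition dotE := (dotDl, dotDr, dotNl, dotNr, dotZl, dotZr).

Lemma dotnorm_sqr u : norm u ^+ 2 = '[u, u].
Proof.
rewrite sqr_sqrtr//; have [->|u0] := eqVneq u 0; first by rewrite linear0l.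
exact/ltW/neq0_dnorm_gt0.
Qed.

Lemma dotnorm_ge0 u : 0 <= norm u.
Proof. exact: sqrtr_ge0. Qed.

Lemma dotnorm0 : norm 0 = 0.
Proof. by rewrite /norm linear0l sqrtr0. Qed.

Lemma dotnorm_eq0 u : (norm u == 0) = (u == 0).
Proof.
have [->|u0] := eqVneq u 0; first by rewrite dotnorm0 eqxx.
by rewrite gt_eqF// sqrtr_gt0 neq0_dnorm_gt0.
Qed.

Lemma dotnorm_gt0 u : (0 < norm u) = (u != 0).
Proof. by rewrite lt0r dotnorm_ge0 andbT dotnorm_eq0. Qed.

Lemma dotnormZ a u : norm (a *: u) = `|a| * norm u.
Proof.
by rewrite /norm dotZl dotZr mulrA -expr2 sqrtrM ?sqr_ge0// sqrtr_sqr.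
Qed.

Lemma dotnormN u : norm (- u) = norm u.
Proof. by rewrite -scaleN1r dotnormZ normrN1 mul1r. Qed.

Lemma dotnormD_sqr u v :
  norm (u + v) ^+ 2 = norm u ^+ 2 + 2 * '[u, v] + norm v ^+ 2.
Proof. by rewrite !dotnorm_sqr !dotE (dotC v u); ring. Qed.

Lemma cauchy_schwarz_defect u v :
  norm (norm v *: u - norm u *: v) ^+ 2 =
  2 * (norm u * norm v) * (norm u * norm v - '[u, v]).
Proof. by rewrite dotnorm_sqr !dotE (dotC v u) -!dotnorm_sqr; ring. Qed.

Lemma cauchy_schwarz u v : '[u, v] <= norm u * norm v.
Proof.
have [->|u0] := eqVneq u 0; first by rewrite linear0l mulr_ge0 ?dotnorm_ge0.
have [->|v0] := eqVneq v 0; first by rewrite linear0r mulr_ge0 ?dotnorm_ge0.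
have := sqr_ge0 (norm (norm v *: u - norm u *: v)).
by rewrite cauchy_schwarz_defect pmulr_rge0 ?subr_ge0// !mulr_gt0 ?dotnorm_gt0.
Qed.

Lemma cauchy_schwarz_eq u v :
  '[u, v] = norm u * norm v -> norm v *: u = norm u *: v.
Proof.
move=> uv; apply/eqP; rewrite -subr_eq0 -dotnorm_eq0 -sqrf_eq0.
by rewrite cauchy_schwarz_defect uv subrr mulr0.
Qed.

Lemma dotnormD u v : norm (u + v) <= norm u + norm v.
Proof.
rewrite -ler_sqr ?nnegrE ?addr_ge0 ?dotnorm_ge0// dotnormD_sqr sqrrD.
by have := cauchy_schwarz u v; lra.
Qed.

Lemma dotnorm_sum I (r : seq I) (P : pred I) (F : I -> U) :
  norm (\sum_(i <- r | P i) F i) <= \sum_(i <- r | P i) norm (F i).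
Proof.
elim/big_ind2: _ => [|u a v b ua vb|//]; first by rewrite dotnorm0.
by rewrite (le_trans (dotnormD _ _))// lerD.
Qed.

Lemma dotnormD_eq_ray u v : norm u + norm v <= norm (u + v) ->
  exists2 t, 0 <= t & u = t *: (u + v).
Proof.
move=> le_uv; have uv : norm (u + v) = norm u + norm v.
  by apply/le_anti; rewrite dotnormD.
have [uv0|uv_neq0] := eqVneq (u + v) 0.
  exists 0 => //; rewrite scale0r; apply/eqP; rewrite -dotnorm_eq0.
  have := dotnorm_ge0 u; have := dotnorm_ge0 v.
  by move: uv; rewrite uv0 dotnorm0; lra.
have dot_uv : '[u, u + v] = norm u * norm (u + v).
  have := dotnormD_sqr u v; rewrite uv sqrrD dotDr -dotnorm_sqr; lra.
exists (norm u / norm (u + v)); first by rewrite divr_ge0 ?dotnorm_ge0.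
apply: (scalerI (_ : norm (u + v) != 0)); first by rewrite dotnorm_eq0.
by rewrite (cauchy_schwarz_eq dot_uv) scalerA mulrC divfK// dotnorm_eq0.
Qed.

Lemma dotnorm_sum_eq_ray (I : finType) (P : pred I) (F : I -> U) k : P k ->
  \sum_(i | P i) norm (F i) <= norm (\sum_(i | P i) F i) ->
  exists2 t, 0 <= t & F k = t *: \sum_(i | P i) F i.
Proof.
move=> Pk; have -> : \sum_(i | P i) F i = _ := bigD1 k Pk.
rewrite (bigD1 k Pk) /= => le_sum.
apply: dotnormD_eq_ray; apply: le_trans le_sum.
by rewrite lerD2l dotnorm_sum.
Qed.

(* The lower bound is Cauchy-Schwarz. The upper one comes from
   2 t N <= N^2 + t^2, where N is the norm on the left-hand side. *)
Lemma dotnorm_sub_far x u t : norm u = 1 -> 0 < t ->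
  0 <= norm (x - t *: u) - t + '[x, u] <= norm x ^+ 2 / (2 * t).
Proof.
move=> u1 t0; have duu : '[u, u] = 1 by rewrite -dotnorm_sqr u1 expr1n.
apply/andP; split.
  have := cauchy_schwarz (x - t *: u) (- u).
  by rewrite dotnormN u1 !dotE duu; lra.
set N := norm _; have NE : N ^+ 2 = norm x ^+ 2 - 2 * t * '[x, u] + t ^+ 2.
  by rewrite /N !dotnorm_sqr !dotE (dotC u x) duu; ring.
rewrite ler_pdivlMr ?mulr_gt0//; have := sqr_ge0 (N - t); nra.
Qed.

Section ZeroSumWeights.
Variables (I : finType) (m : I -> R) (x : I -> U).
Hypothesis m_sum0 : \sum_i m i = 0.

Lemma sum0_dotnorm_far u t : norm u = 1 -> 0 < t ->
  `|\sum_i m i * norm (x i - t *: u) + '[\sum_i m i *: x i, u]| <=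
  (\sum_i `|m i| * norm (x i) ^+ 2) / (2 * t).
Proof.
move=> u1 t0.
have -> : \sum_i m i * norm (x i - t *: u) + '[\sum_i m i *: x i, u] =
          \sum_i m i * (norm (x i - t *: u) - t + '[x i, u]).
  under [RHS]eq_bigr do rewrite mulrDr mulrBr.
  rewrite big_split sumrB -mulr_suml m_sum0 mul0r subr0 linear_sumlz.
  by congr (_ + _); apply: eq_bigr => i _; exact: dotZl.
rewrite (le_trans (ler_norm_sum _ _ _))// mulr_suml; apply: ler_sum => i _.
have /andP[ge0 le_far] := dotnorm_sub_far (x i) u1 t0.
by rewrite normrM (ger0_norm ge0) -mulrA ler_wpM2l.
Qed.

(* Let v tend to infinity in the direction opposite to the weighted sum. *)
Lemma sum0_affine_dependence :
  (forall v, \sum_i m i * norm (x i - v) <= 0) -> \sum_i m i *: x i = 0.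
Proof.
move=> m_le0; set w := \sum_i _.
apply/eqP/negPn/negP; rewrite -dotnorm_gt0 => w0.
pose u := (- (norm w)^-1) *: w.
have u1 : norm u = 1.
  by rewrite dotnormZ normrN gtr0_norm ?invr_gt0// mulVf ?gt_eqF.
have wu : '[w, u] = - norm w.
  by rewrite dotZr -dotnorm_sqr mulNr expr2 mulKf ?gt_eqF.
pose M : R := \sum_i `|m i| * norm (x i) ^+ 2.
have M0 : 0 <= M by apply: sumr_ge0 => i _; rewrite mulr_ge0 ?sqr_ge0.
have [t t0 tE] : exists2 t, 0 < t & norm w * t = M + 1.
  exists ((M + 1) / norm w); first by rewrite divr_gt0// ltr_wpDl.
  by rewrite mulrC divfK ?gt_eqF.
have := sum0_dotnorm_far u1 t0.
rewrite -/w -/M wu ler_norml => /andP[far _].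
have {far} : norm w <= M / (2 * t) by have := m_le0 (t *: u); lra.
by rewrite ler_pdivlMr ?mulr_gt0// mulrCA tE; lra.
Qed.

End ZeroSumWeights.

End DotNorm.

Section ConvexHull.
Variables (R : realFieldType) (U : lmodType R).
Implicit Types (A B : set U) (x y z : U) (a b : R).

Lemma convex_set_weighted2 B x y a b : convex_set B -> B x -> B y ->
  0 <= a -> 0 <= b -> exists2 z, B z & a *: x + b *: y = (a + b) *: z.
Proof.
move=> cB Bx By a0 b0; have [ab0|ab_neq0] := eqVneq (a + b) 0.
  have [-> ->] : a = 0 /\ b = 0 by split; lra.
  by exists x; rewrite // addr0 !scale0r addr0.
have ab_gt0 : 0 < a + b by rewrite lt0r ab_neq0 addr_ge0.
have t0 : 0 <= a / (a + b) by rewrite divr_ge0// ltW.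
have t1 : a / (a + b) <= 1 by rewrite ler_pdivrMr// mul1r lerDl.
exists (a / (a + b) *: x + (1 - a / (a + b)) *: y).
  by have := cB x y (Itv01 t0 t1); rewrite !inE; apply.
rewrite scalerDr !scalerA; congr (_ *: _ + _ *: _); first by field.
by field.
Qed.

Lemma convex_set_weighted_sum (I : finType) (P : pred I) (c : I -> R)
    (x : I -> U) B z :
  convex_set B -> (forall i, P i -> 0 <= c i) -> (forall i, P i -> B (x i)) ->
  0 < \sum_(i | P i) c i ->
  \sum_(i | P i) c i *: x i = (\sum_(i | P i) c i) *: z -> B z.
Proof.
move=> cB c0 Bx sum_gt0 zE.
have [i0 /andP[Pi0 _]] := psumr_neq0P c0 (elimN eqP (lt0r_neq0 sum_gt0)).
pose weighted v s := 0 <= s /\ exists2 y, B y & v = s *: y.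
have [_ [y By]] : weighted (\sum_(i | P i) c i *: x i) (\sum_(i | P i) c i).
  apply: (big_ind2 weighted).
  - by split=> //; exists (x i0); [exact: Bx|rewrite scale0r].
  - move=> _ s _ t [s0 [y By ->]] [t0 [y' By' ->]].
    by split; [exact: addr_ge0|exact: convex_set_weighted2].
  - by move=> i Pi; split; [exact: c0|exists (x i) => //; exact: Bx].
by rewrite zE => /(scalerI (lt0r_neq0 sum_gt0)) ->.
Qed.

Lemma convex_set_opposite_rays B y z w a b : convex_set B -> B y -> B z ->
  0 <= a -> 0 <= b -> w - y = a *: (z - y) -> w - z = b *: (y - z) -> B w.
Proof.
move=> cB By Bz a0 b0 wy wz.
have [yz|yz] := eqVneq y z.
  by move: wy; rewrite yz subrr scaler0 => /subr0_eq ->.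
have ab1 : a + b = 1.
  have : (a + b - 1) *: (z - y) = 0.
    rewrite scalerBl scale1r scalerDl -wy -(opprB y z) scalerN -wz.
    by rewrite opprB [w - y - _]addrC opprB addrA subrK subrr.
  move=> /eqP; rewrite scaler_eq0 !subr_eq0 (eq_sym z) (negPf yz) orbF.
  by move/eqP.
have [v Bv vE] := convex_set_weighted2 cB By Bz b0 a0.
have -> : w = b *: y + a *: z.
  rewrite -[w](subrK y) wy scalerBr -addrA addrC; congr (_ + _).
  by rewrite -[X in _ + X]scale1r -ab1 scalerDl addKr.
by rewrite vE addrC ab1 scale1r.
Qed.

Lemma convex_set_smallest A : convex_set (smallest (@convex_set R U) A).
Proof.
move=> x y l; rewrite !inE => Ax Ay B [cB AB].
by have := cB x y l; rewrite !inE; apply; [apply: Ax|apply: Ay].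
Qed.

Lemma convex_set_sublevel (f : U -> R^o) (c : R) :
  convex_function setT f -> convex_set [set x | f x <= c].
Proof.
move=> f_convex x y t; rewrite !inE /= => fx fy.
apply: le_trans (f_convex t x y _ _) _; rewrite ?inE//.
rewrite -(convmm t (c : R^o)).
by rewrite lerD// ler_wpM2l// subr_ge0.
Qed.

End ConvexHull.

Section PositivePoints.
Variables (R : rcfType) (U : lmodType R) (form : {dot U for @idfun R}).
Variables (I : finType) (m : I -> R) (x : I -> U).

Local Notation norm := (dotnorm form).

Hypotheses (m_sum0 : \sum_i m i = 0)
  (m_le0 : forall v, \sum_i m i * norm (x i - v) <= 0).

Lemma positive_point_on_ray j j' k : m j' < 0 -> 0 < m k ->
    (forall i, i != j -> i != j' -> 0 <= m i) ->
  exists2 t, 0 <= t & x k - x j = t *: (x j' - x j).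
Proof.
move=> mj' mk m_ge0; have kj' : k != j'.
  by apply: contraTneq mk => ->; rewrite -leNgt ltW.
have sum_diff0 : \sum_i m i *: (x i - x j) = 0.
  under eq_bigr do rewrite scalerBr.
  rewrite sumrB -scaler_suml m_sum0 scale0r subr0.
  exact: sum0_affine_dependence m_sum0 m_le0.
have sum_diff : \sum_(i | i != j') m i *: (x i - x j) = - m j' *: (x j' - x j).
  move: sum_diff0; rewrite (bigD1 j')//= addrC => /eqP.
  by rewrite addr_eq0 -scaleNr => /eqP.
have [||t t0 xk] := @dotnorm_sum_eq_ray _ _ form _ (fun i => i != j')
    (fun i => m i *: (x i - x j)) k => //.
  rewrite sum_diff dotnormZ gtr0_norm ?oppr_gt0//.
  have := m_le0 (x j); rewrite (bigD1 j')//= addrC -lerBrDr sub0r -mulNr.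
  apply: le_trans; apply: ler_sum => i ij'; rewrite dotnormZ.
  have [->|ij] := eqVneq i j; first by rewrite subrr dotnorm0 !mulr0.
  by rewrite ger0_norm// m_ge0.
exists (t * - m j' / m k).
  by rewrite divr_ge0 ?mulr_ge0 ?oppr_ge0// ltW.
apply: (scalerI (lt0r_neq0 mk)).
by rewrite xk sum_diff !scalerA; congr (_ *: _); field; rewrite lt0r_neq0.
Qed.

Lemma positive_point_convex_two_neg B j j' k : convex_set B ->
    B (x j) -> B (x j') -> m j < 0 -> m j' < 0 -> 0 < m k ->
    (forall i, i != j -> i != j' -> 0 <= m i) -> B (x k).
Proof.
move=> cB Bj Bj' mj mj' mk m_ge0.
have [t t0 xkj] := positive_point_on_ray mj' mk m_ge0.
have [|t' t'0 xkj'] := @positive_point_on_ray j' j k mj mk.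
  by move=> i ij' ij; exact: m_ge0.
exact: (convex_set_opposite_rays cB Bj Bj' t0 t'0 xkj xkj').
Qed.

Lemma positive_point_convex_one_pos B k : convex_set B ->
    (forall i, m i < 0 -> B (x i)) -> 0 < m k ->
    (forall i, i != k -> m i <= 0) -> B (x k).
Proof.
move=> cB Bx mk m_npos.
have sum_m : \sum_(i | m i < 0) - m i = m k.
  exact: sum_neg_part_unique_pos.
have sum_mx : \sum_(i | m i < 0) - (m i *: x i) = m k *: x k.
  apply: (sum_neg_part_unique_pos (m := m)) => // [i ->|].
    by rewrite scale0r.
  exact: sum0_affine_dependence m_sum0 m_le0.
apply: (@convex_set_weighted_sum _ _ _ (fun i => m i < 0) (fun i => - m i) x).
- exact: cB.
- by move=> i mi; rewrite oppr_ge0 ltW.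
- exact: Bx.
- by rewrite sum_m.
- by rewrite sum_m -sum_mx; apply: eq_bigr => i _; rewrite scaleNr.
Qed.

Lemma positive_point_convex B k : (#|I| <= 4)%N -> convex_set B ->
  (forall i, m i < 0 -> B (x i)) -> 0 < m k -> B (x k).
Proof.
move=> I4 cB Bx mk.
have [/forall_inP m_npos|] := boolP [forall i in predC1 k, m i <= 0].
  exact: positive_point_convex_one_pos.
rewrite negb_forall_in => /exists_inP[q qk]; rewrite -ltNge => mq.
pose N := [set i | m i < 0]%SET.
have [j mj] := sum0_exists_lt0 m_sum0 mk.
have Nj : j \in N by rewrite inE.
have card_N : (#|N| <= 2)%N.
  rewrite -(leq_add2r 2) (leq_trans _ I4)// -(cardsC N) leq_add2l.
  have <- : #|[set q; k]%SET| = 2%N by rewrite cards2 (qk : q != k).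
  apply/subset_leq_card/fintype.subsetP => i; rewrite !inE -leNgt.
  by case/orP => /eqP ->; exact: ltW.
have [j' Nj' N_sub] := card_le2_sub_set2 Nj card_N.
have others i : i != j -> i != j' -> 0 <= m i.
  move=> ij ij'; rewrite leNgt; apply/negP => mi.
  have /(fintype.subsetP N_sub) : i \in N by rewrite inE.
  by rewrite !inE (negPf ij) (negPf ij').
rewrite inE in Nj'.
exact: (positive_point_convex_two_neg cB (Bx j mj) (Bx j' Nj') mj Nj').
Qed.

End PositivePoints.

Section Euclidean.
Variables (R : realType) (d : nat).
Implicit Types (x y v : 'rV[R]_d) (V : {mset 'rV[R]_d}%mset).

Definition dotrv x y : R := \sum_i x ord0 i * y ord0 i.

Lemma dotrv_is_bilinear :
  bilinear_for (GRing.Scale.Law.clone _ _ *%R _)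
    (GRing.Scale.Law.clone _ _ (@idfun R \; *%R) _) dotrv.
Proof.
split=> [z|z] a x y /=; rewrite /dotrv mulr_sumr -big_split /=;
  by apply: eq_bigr => i _; rewrite !mxE; ring.
Qed.

HB.instance Definition _ :=
  bilinear_isBilinear.Build R _ _ _ _ _ dotrv dotrv_is_bilinear.

Lemma dotrv_sym x y : dotrv x y = (-1) ^+ false * idfun (dotrv y x).
Proof. by rewrite mul1r; apply: eq_bigr => i _; rewrite mulrC. Qed.

HB.instance Definition _ :=
  isHermitianSesquilinear.Build _ _ _ _ dotrv dotrv_sym.

Lemma dotrv_gt0 x : x != 0 -> 0 < dotrv x x.
Proof.
case/rV0Pn => i xi; rewrite /dotrv (bigD1 i)//= ltr_pwDl//.
  by rewrite -expr2 exprn_even_gt0.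
by apply: sumr_ge0 => j _; rewrite -expr2 sqr_ge0.
Qed.

HB.instance Definition _ := isDotProduct.Build _ _ dotrv dotrv_gt0.

Lemma enormE x : enorm x = dotnorm dotrv x.
Proof. by congr Num.sqrt; apply: eq_bigr => i _; rewrite expr2. Qed.

Lemma dist_sum0 x : dist_sum mset0 x = 0.
Proof. by rewrite /dist_sum enum_mset0 big_nil. Qed.

Lemma dist_sum1 v x : dist_sum [mset v]%mset x = enorm (x - v).
Proof. by rewrite /dist_sum enum_msetn big_seq1. Qed.

Lemma dist_sumD V W x :
  dist_sum (V `+` W)%mset x = dist_sum V x + dist_sum W x.
Proof.
rewrite /dist_sum -big_cat; apply: perm_big; apply/allP => v _ /=.
by rewrite count_cat !count_mem_mset msetE2.
Qed.

Lemma dist_sum_convex V : convex_function setT (dist_sum V : _ -> R^o).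
Proof.
move=> t x y _ _; rewrite [leRHS]convRE /dist_sum !mulr_sumr -big_split /=.
apply: ler_sum => v _; rewrite !enormE.
have -> : (x : convex_lmodType _) <| t |> y - v =
          t%:num *: (x - v) + (1 - t%:num) *: (y - v).
  by rewrite !scalerBr addrACA -opprD -scalerDl subrKC scale1r.
apply: le_trans (dotnormD _ _ _) _.
by rewrite !dotnormZ !ger0_norm ?subr_ge0.
Qed.

Lemma sorted_dist_sum_protrusive V s :
  sorted (fun x y => dist_sum V x < dist_sum V y) s -> protrusive s.
Proof.
have lt_dist_trans : transitive (fun x y => dist_sum V x < dist_sum V y).
  by move=> ? ? ?; exact: lt_trans.
move=> s_sorted [//|i] /= i_lt hull_i.
have : dist_sum V s`_i.+1 <= dist_sum V s`_i.
  have sublevel_convex :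
      convex_set [set x | dist_sum V x <= dist_sum V s`_i].
    exact: convex_set_sublevel (@dist_sum_convex V).
  apply: (smallest_sub sublevel_convex _ hull_i).
  move=> x /= /(nthP 0)[j]; rewrite size_takel ?(ltnW i_lt)// ltnS => ji <-.
  rewrite nth_take//; move: ji; rewrite leq_eqVlt => /predU1P[->//|ji].
  apply/ltW/(sorted_ltn_nth lt_dist_trans) => //; rewrite inE ?(ltnW i_lt)//.
  exact: ltn_trans ji (ltnW i_lt).
by rewrite leNgt (sortedP 0 s_sorted).
Qed.

Definition dist_increment s V (i : nat) : R :=
  dist_sum V s`_i.+1 - dist_sum V s`_i.

Lemma dist_increment1 s v i :
  dist_increment s [mset v]%mset i =
  dotnorm dotrv (s`_i.+1 - v) - dotnorm dotrv (s`_i - v).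
Proof. by rewrite /dist_increment !dist_sum1 !enormE. Qed.

Lemma protrusive_weighted_increment n s (w : nat -> R) :
    size s = n.+2 -> (size s <= 4)%N -> protrusive s ->
    (forall i, 0 <= w i) -> (forall i, (n < i)%N -> w i = 0) ->
    (exists i, 0 < w i) ->
  exists v, 0 < \sum_(i < n.+1) w i * dist_increment s [mset v]%mset i.
Proof.
move=> sz_s s4 pro w_ge0 w_supp w_pos; apply: contrapT => no_v.
have [k [k_le mk m_neg]] := backward_diff_last_pos w_ge0 w_supp w_pos.
have k_lt : (k.+1 < n.+2)%N by rewrite !ltnS.
pose m (j : 'I_n.+2) := backward_diff w j.
have m_sum0 : \sum_j m j = 0 by apply: sum_backward_diff; exact: w_supp.
have m_le0 v : \sum_j m j * dotnorm dotrv (s`_j - v) <= 0.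
  rewrite (sum_backward_diffM (fun j => dotnorm dotrv (s`_j - v))) ?w_supp//.
  rewrite leNgt; apply/negP => v_pos; apply: no_v; exists v.
  by under eq_bigr do rewrite dist_increment1.
apply: (pro k.+1); first by rewrite sz_s.
apply: (positive_point_convex m_sum0 m_le0 (k := Ordinal k_lt)) => //.
- by rewrite card_ord -sz_s.
- exact: convex_set_smallest.
- move=> j mj; apply: sub_gen_smallest => /=.
  have jk : (j < k.+1)%N by rewrite ltnS m_neg.
  by rewrite -(nth_take _ jk) mem_nth// size_takel ?sz_s// ltnW.
Qed.

Lemma protrusive_sorted_dist_sum s : (size s <= 4)%N -> protrusive s ->
  exists V, V <> mset0 /\ sorted (fun x y => dist_sum V x < dist_sum V y) s.
Proof.
move=> s4 pro; have [s1|s2] := leqP (size s) 1.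
  exists [mset 0]%mset; split; last by case: s s1 {s4 pro} => [|x []].
  by move=> /msetP/(_ 0); rewrite msetnxx mset0E.
have [n sz_s] : exists n, size s = n.+2.
  by exists (size s).-2; rewrite -[LHS](subnK s2) addn2 subn2.
apply: contrapT => no_V.
have [||w [w_ge0 w_supp w_pos w_le0]] :=
    @add_closed_nonpos_functional R n (range (dist_increment s)).
- move=> _ _ [V _ <-] [W _ <-]; exists (V `+` W)%mset => //.
  by apply/funext => i; rewrite addrfctE /dist_increment !dist_sumD; ring.
- move=> _ [V _ <-]; apply: contrapT => V_incr; apply: no_V; exists V.
  have lt_dist i : (i <= n)%N -> dist_sum V s`_i < dist_sum V s`_i.+1.
    move=> i_le; rewrite -subr_gt0 ltNge; apply/negP => incr_le0.
    by apply: V_incr; exists i.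
  split; first by move=> V0; have := lt_dist 0 isT; rewrite V0 !dist_sum0 ltxx.
  by apply/(sortedP 0) => i; rewrite sz_s; exact: lt_dist.
have [v] := protrusive_weighted_increment sz_s s4 pro w_ge0 w_supp w_pos.
by rewrite ltNge w_le0//; exists [mset v]%mset.
Qed.

End Euclidean.

Local Open Scope fset_scope.
Local Open Scope ring_scope.

Theorem theorem7p4 (R : realType) (d : nat) (hd : (1 <= d)%N)
    (C : {fset 'rV[R]_d}) (hC : (#|` C| <= 4)%N) :
  Psi C = [set s | ordering C s /\ protrusive s].
Proof.
apply/seteqP; split=> [s [V [_ [_ Cs s_sorted]]]|s [[s_uniq sC] pro]] /=.
  by split=> //; exact: sorted_dist_sum_protrusive s_sorted.
have s4 : (size s <= 4)%N.
  by apply: leq_trans hC; apply: uniq_leq_size s_uniq _ => x; rewrite sC.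
have [V [V0 s_sorted]] := protrusive_sorted_dist_sum s4 pro.
exists V; split=> //; split=> // x y xC yC.
by apply: (sorted_lt_inj s_sorted); rewrite sC.
Qed.
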